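(* For every integer $n\ge 2$, the lattice $\mathcal{D}_{n}$ of Dyck paths of length $2n$ is isomorphic (as a lattice) to $\beta_{n-1}(\mathcal{D}_{n-1})$, the lattice obtained from $\mathcal{D}_{n-1}$ by the successive filtered doublings with respect to the filters $F_{(n-1)1},F_{(n-1)2},\ldots,F_{(n-1)(n-1)}$.
   Context: $\mathbf{N}$ is the set of nonnegative integers; $[x,y]$ denotes an interval of integers. For $m\in\mathbf{N}$, $\mathcal{D}_{m}$ is the set of Dyck paths of length $2m$, i.e. functions $f:[0,2m]\to\mathbf{N}$ with $f(0)=f(2m)=0$ and $f(i+1)-f(i)\in\{-1,1\}$ for all $0\le i<2m$, ordered by $f\le g$ iff $f(i)\le g(i)$ for all $i$; it is a finite distributive lattice with coordinatewise meet (minimum) and join (maximum). A rise step is a step $+1$, a fall step is a step $-1$. A filter of a lattice is a subset closed under meets and upward closed. Given a lattice $\mathbf{L}$ and a filter $F$ of $\mathbf{L}$, the $F$-filtered doubling of $\mathbf{L}$ is the lattice $$\mathbf{L}\times_{F}\mathbf{2}=\{(x,e)\in \mathbf{L}\times\{0,1\}\mid e=1\Rightarrow x\in F\}$$ with coordinatewise meet and join (where $0<1$). Fix $n\ge2$. For $1\le k\le n-1$, $F_{(n-1)k}\subseteq\mathcal{D}_{n-1}$ is the set of all Dyck paths in $\mathcal{D}_{n-1}$ whose first $k$ steps are all rise steps (with no condition on the $(k+1)$-st step); it is a filter of $\mathcal{D}_{n-1}$, $F_{(n-1)1}=\mathcal{D}_{n-1}$, and $F_{(n-1)(k+1)}\subseteq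 F_{(n-1)k}$. Recursively define $$\beta_{1}(\mathcal{D}_{n-1})=\mathcal{D}_{n-1}\times_{F_{(n-1)1}}\mathbf{2}=\mathcal{D}_{n-1}\times\mathbf{2},\qquad \beta_{k}(\mathcal{D}_{n-1})=\beta_{k-1}(\mathcal{D}_{n-1})\times_{F_{(n-1)k}}\mathbf{2}\quad(2\le k<n),$$ where $F_{(n-1)k}$ is regarded as a filter of $\beta_{k-1}(\mathcal{D}_{n-1})$ as follows: for $x\in\mathcal{D}_{n-1}$ put $\langle x\rangle_{0}=x$, and for $j\ge1$ and $x\in F_{(n-1)j}$ put $\langle x\rangle_{j}=(\langle x\rangle_{j-1},1)\in\beta_{j}(\mathcal{D}_{n-1})$; then $F_{(n-1)k}$ is identified with the subset $\{\langle x\rangle_{k-1}\mid x\in F_{(n-1)k}\}$ of $\beta_{k-1}(\mathcal{D}_{n-1})$, which is a filter of it. *)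

(* Defs.v *)
From HB Require Import structures.
From mathcomp Require Import all_boot all_order zify.
Set Implicit Arguments. Unset Strict Implicit. Unset Printing Implicit Defensive.
Import Order.Theory.
Local Open Scope order_scope.

Definition lattice_isomorphic d1 d2
    (L1 : latticeType d1) (L2 : latticeType d2) : Prop :=
  exists f : L1 -> L2,
    [/\ bijective f,
        {morph f : x y / x `&` y} &
        {morph f : x y / x `|` y}].

(* Filters may be empty, as only closure under meets and upward closure are
   required. *)
Record filter d (L : latticeType d) := Filter {
  filter_mem :> {pred L};
  filterI : forall x y, x \in filter_mem -> y \in filter_mem ->
    x `&` y \in filter_mem;
  filter_up : forall x y, x \in filter_mem -> x <= y -> y \in filter_mem
}.

Section Doubling.
Context (d : Order.disp_t) (L : latticeType d) (F : filter L).

Definition fdouble_pred : {pred L *prod[d] bool} :=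
  fun p => p.2 ==> (p.1 \in F).

Record fdouble := FDouble {
  fdouble_val :> L *prod[d] bool;
  fdouble_valP : fdouble_pred fdouble_val
}.

HB.instance Definition _ := [isSub for fdouble_val].
HB.instance Definition _ := [Choice of fdouble by <:].

Fact fdouble_meet_closed : meet_closed fdouble_pred.
Proof.
move=> [x [] /=] [y [] /=]; rewrite !unfold_in //= => Fx Fy.
exact: filterI.
Qed.

Fact fdouble_join_closed : join_closed fdouble_pred.
Proof.
move=> [x [] /=] [y [] /=]; rewrite !unfold_in //= => Fx Fy.
- exact: filter_up Fx (leUl _ _).
- exact: filter_up Fx (leUl _ _).
- exact: filter_up Fy (leUr _ _).
Qed.

HB.instance Definition _ := Order.SubChoice_isSubLattice.Build
  d (L *prod[d] bool)%type fdouble_pred d fdouble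
  fdouble_meet_closed fdouble_join_closed.

Lemma fdouble_meetE (p q : fdouble) :
  val (p `&` q) = ((val p).1 `&` (val q).1, (val p).2 && (val q).2).
Proof. by []. Qed.

Lemma fdouble_joinE (p q : fdouble) :
  val (p `|` q) = ((val p).1 `|` (val q).1, (val p).2 || (val q).2).
Proof. by []. Qed.

Lemma fdouble_leE (p q : fdouble) :
  (p <= q) = ((val p).1 <= (val q).1) && ((val p).2 ==> (val q).2).
Proof.
rewrite -Order.le_val Order.ProdOrder.leEprod.
by case: (val p).2; case: (val q).2.
Qed.

End Doubling.

HB.instance Definition _ d (L : finLatticeType d) (F : filter L) :=
  [Finite of fdouble F by <:].

Section IteratedDoubling.
Context (d : Order.disp_t) (D : finLatticeType d) (F : nat -> filter D).
Hypothesis F_decr : forall k, {subset F k.+1 <= F k}.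

(* Stage k consists of the k-th iterated doubling beta_k of D and of the map
   x |-> <x>_k from F k to beta_k.  The other fields are the facts making
   {<x>_k | x \in F k.+1} a filter of beta_k. *)
Record stage k := Stage {
  stage_lattice : finLatticeType d;
  bracket : {x : D | x \in F k} -> stage_lattice;
  bracketI : forall x y z, val z = val x `&` val y ->
    bracket z = bracket x `&` bracket y;
  bracket_le : forall x y, bracket x <= bracket y -> val x <= val y;
  bracket_up : forall x b, bracket x <= b -> exists y, b = bracket y
}.

Definition restrict k (x : {x : D | x \in F k.+1}) : {x : D | x \in F k} :=
  exist _ (val x) (F_decr (valP x)).

Section NextStage.
Context (k : nat) (s : stage k).

Definition next_pred : {pred stage_lattice s} :=
  fun b => [exists x : {x : D | x \in F k.+1}, b == bracket s (restrict x)].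

Fact next_predI b c :
  b \in next_pred -> c \in next_pred -> b `&` c \in next_pred.
Proof.
move=> /existsP[x /eqP->] /existsP[y /eqP->]; apply/existsP.
have Fz := filterI (valP x) (valP y).
by exists (exist (fun z => z \in F k.+1) _ Fz); apply/eqP/esym/bracketI.
Qed.

Fact next_pred_up b c : b \in next_pred -> b <= c -> c \in next_pred.
Proof.
move=> /existsP[x /eqP->] /[dup] /bracket_up[y ->] /bracket_le /= lexy.
have Fy := filter_up (valP x) lexy.
apply/existsP; exists (exist (fun z => z \in F k.+1) _ Fy); apply/eqP.
congr bracket.
exact: val_inj.
Qed.

Definition next_filter : filter (stage_lattice s) :=
  Filter next_predI next_pred_up.

Fact next_bracketP (x : {x : D | x \in F k.+1}) :
  fdouble_pred next_filter (bracket s (restrict x), true).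
Proof. by apply/existsP; exists x. Qed.

Definition next_bracket x : fdouble next_filter := FDouble (next_bracketP x).

Fact next_bracketI x y z : val z = val x `&` val y ->
  next_bracket z = next_bracket x `&` next_bracket y.
Proof.
move=> xyz; apply: val_inj; rewrite fdouble_meetE /=; congr pair.
exact: bracketI.
Qed.

Fact next_bracket_le x y : next_bracket x <= next_bracket y -> val x <= val y.
Proof. by rewrite fdouble_leE => /andP[/bracket_le]. Qed.

Fact next_bracket_up x b : next_bracket x <= b -> exists y, b = next_bracket y.
Proof.
rewrite fdouble_leE; case: b => -[b []] Fb /andP[//= _ _].
have /existsP[y /eqP /= eq_b] := Fb.
by exists y; apply: val_inj; rewrite /= eq_b.
Qed.

Definition next_stage : stage k.+1 :=
  @Stage k.+1 (fdouble next_filter)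
    next_bracket next_bracketI next_bracket_le next_bracket_up.

End NextStage.

Hypothesis F0 : forall x, x \in F 0.

Fact bracket0_up (x : {x : D | x \in F 0}) b :
  val x <= b -> exists y : {x : D | x \in F 0}, b = val y.
Proof. by exists (exist _ b (F0 b)). Qed.

Definition stage0 : stage 0 :=
  @Stage 0 D val (fun _ _ _ => id) (fun _ _ => id) bracket0_up.

Fixpoint stages k : stage k :=
  if k is k'.+1 then next_stage (stages k') else stage0.

Definition iter_fdouble k : finLatticeType d := stage_lattice (stages k).

End IteratedDoubling.

Section Dyck.
Context (m : nat).
Implicit Types (f g : {ffun 'I_(m.*2.+1) -> nat}) (i : 'I_m.*2).

(* A step i of a path goes from its value at i to its value at i + 1. *)
Definition rise_step f i :=
  f (lift ord0 i) == (f (widen_ord (leqnSn _) i)).+1.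
Definition fall_step f i :=
  f (widen_ord (leqnSn _) i) == (f (lift ord0 i)).+1.

Definition is_dyck f :=
  [&& f ord0 == 0%N, f ord_max == 0%N &
      [forall i, rise_step f i || fall_step f i]].

Record dyck := Dyck {
  dyck_val :> {ffun 'I_(m.*2.+1) -> nat};
  _ : is_dyck dyck_val
}.

HB.instance Definition _ := [isSub for dyck_val].
HB.instance Definition _ := [Choice of dyck by <:].

Implicit Types (x y z : dyck).

Lemma dyck_start x : x ord0 = 0%N.
Proof. by case/and3P: (valP x) => /eqP. Qed.

Lemma dyck_end x : x ord_max = 0%N.
Proof. by case/and3P: (valP x) => _ /eqP. Qed.

Lemma dyck_step x i : rise_step x i || fall_step x i.
Proof. by case/and3P: (valP x) => _ _ /forallP. Qed.

Lemma ord_step_ind (P : 'I_m.*2.+1 -> Prop) : P ord0 ->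
  (forall i, P (widen_ord (leqnSn _) i) -> P (lift ord0 i)) -> forall j, P j.
Proof.
move=> P0 PS [j]; elim: j => [|j IHj] lt_j.
  by rewrite (_ : Ordinal _ = ord0) //; apply: val_inj.
have := PS (Ordinal (lt_j : (j < m.*2)%N)).
rewrite (_ : widen_ord _ _ = Ordinal (ltnW lt_j)); last exact: val_inj.
move=> /(_ (IHj _)); rewrite (_ : lift _ _ = Ordinal lt_j) //.
exact: val_inj.
Qed.

Lemma dyck_odd x (j : 'I_m.*2.+1) : odd (x j) = odd j.
Proof.
elim/ord_step_ind: j => [|i IHi]; first by rewrite dyck_start.
have /orP[/eqP->|/eqP e] := dyck_step x i; first by rewrite /= IHi.
by move: IHi; rewrite e /= => /(congr1 negb); rewrite negbK.
Qed.

Lemma dyck_bound x (j : 'I_m.*2.+1) : (x j <= j)%N.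
Proof.
elim/ord_step_ind: j => [|i]; first by rewrite dyck_start.
rewrite lift0 /= => IHi; have /orP[/eqP-> //|/eqP e] := dyck_step x i.
by rewrite ltnW // (leq_trans _ (leqW IHi)) // e.
Qed.

Definition dyck_code x : {ffun 'I_m.*2.+1 -> 'I_m.*2.+1} :=
  [ffun j => inord (x j)].
Definition dyck_decode (c : {ffun 'I_m.*2.+1 -> 'I_m.*2.+1}) : option dyck :=
  insub [ffun j => val (c j)].

Fact dyck_codeK : pcancel dyck_code dyck_decode.
Proof.
move=> x; rewrite /dyck_decode (_ : [ffun _ => _] = val x) ?valK //.
apply/ffunP => j; rewrite !ffunE /= inordK //.
exact: leq_ltn_trans (dyck_bound x j) (ltn_ord j).
Qed.

HB.instance Definition _ := PCanIsCountable dyck_codeK.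
HB.instance Definition _ : isFinite dyck := PCanIsFinite dyck_codeK.

Fact dyck_meetP x y : is_dyck [ffun j => minn (x j) (y j)].
Proof.
rewrite /is_dyck !ffunE !dyck_start !dyck_end /=; apply/forallP => i.
have := dyck_odd x (widen_ord (leqnSn _) i).
rewrite -(dyck_odd y); have := dyck_step x i; have := dyck_step y i.
rewrite /rise_step /fall_step !ffunE; lia.
Qed.

Fact dyck_joinP x y : is_dyck [ffun j => maxn (x j) (y j)].
Proof.
rewrite /is_dyck !ffunE !dyck_start !dyck_end /=; apply/forallP => i.
have := dyck_odd x (widen_ord (leqnSn _) i).
rewrite -(dyck_odd y); have := dyck_step x i; have := dyck_step y i.
rewrite /rise_step /fall_step !ffunE; lia.
Qed.

Definition dyck_le x y := [forall j, (x j <= y j)%N].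
Definition dyck_lt x y := (y != x) && dyck_le x y.
Definition dyck_meet x y := Dyck (dyck_meetP x y).
Definition dyck_join x y := Dyck (dyck_joinP x y).

Lemma dyck_eqP x y : x =1 y <-> x = y.
Proof. by split=> [/ffunP /val_inj | ->]. Qed.

Fact dyck_le_def x y : dyck_le x y = (dyck_meet x y == x).
Proof.
apply/forallP/eqP => [le_xy | /dyck_eqP e j]; last first.
  by rewrite -e ffunE geq_minr.
by apply/dyck_eqP => j; rewrite ffunE; apply/minn_idPl.
Qed.

Fact dyck_meetC : commutative dyck_meet.
Proof. by move=> x y; apply/dyck_eqP => j; rewrite !ffunE minnC. Qed.

Fact dyck_joinC : commutative dyck_join.
Proof. by move=> x y; apply/dyck_eqP => j; rewrite !ffunE maxnC. Qed.

Fact dyck_meetA : associative dyck_meet.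
Proof. by move=> x y z; apply/dyck_eqP => j; rewrite !ffunE minnA. Qed.

Fact dyck_joinA : associative dyck_join.
Proof. by move=> x y z; apply/dyck_eqP => j; rewrite !ffunE maxnA. Qed.

Fact dyck_joinKI y x : dyck_meet x (dyck_join x y) = x.
Proof. by apply/dyck_eqP => j; rewrite !ffunE; lia. Qed.

Fact dyck_meetKU y x : dyck_join x (dyck_meet x y) = x.
Proof. by apply/dyck_eqP => j; rewrite !ffunE; lia. Qed.

Fact dyck_meetUl : left_distributive dyck_meet dyck_join.
Proof. by move=> x y z; apply/dyck_eqP => j; rewrite !ffunE minn_maxl. Qed.

Fact dyck_meetxx : idempotent_op dyck_meet.
Proof. by move=> x; apply/dyck_eqP => j; rewrite !ffunE minnn. Qed.

Fact dyck_display : Order.disp_t. Proof. exact: Order.Disp tt tt. Qed.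

HB.instance Definition _ := Order.isMeetJoinDistrLattice.Build dyck_display dyck
  dyck_le_def (fun _ _ => erefl) dyck_meetC dyck_joinC dyck_meetA dyck_joinA
  dyck_joinKI dyck_meetKU dyck_meetUl dyck_meetxx.

Lemma dyck_leP x y : reflect (forall j, (x j <= y j)%N) (x <= y).
Proof. exact: forallP. Qed.

Lemma dyck_meetE x y j : (x `&` y) j = minn (x j) (y j).
Proof. by rewrite ffunE. Qed.

Lemma dyck_joinE x y j : (x `|` y) j = maxn (x j) (y j).
Proof. by rewrite ffunE. Qed.

Section RiseFilter.
Context (k : nat).

Definition rise_pred : {pred dyck} :=
  fun x => [forall i : 'I_m.*2, (i < k)%N ==> rise_step x i].

Lemma rise_predP x :
  reflect (forall j : 'I_m.*2.+1, (j <= k)%N -> x j = j) (x \in rise_pred).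
Proof.
apply: (iffP forallP) => [rise_x | x_id i].
  elim/ord_step_ind => [|i IHi]; first by rewrite dyck_start.
  rewrite lift0 => lt_ik; have /implyP/(_ lt_ik)/eqP -> := rise_x i.
  by rewrite IHi //= ltnW.
by apply/implyP => lt_ik; rewrite /rise_step !x_id ?lift0 //= ltnW.
Qed.

Fact rise_predI x y :
  x \in rise_pred -> y \in rise_pred -> x `&` y \in rise_pred.
Proof.
move=> /rise_predP x_id /rise_predP y_id; apply/rise_predP => j le_jk.
by rewrite dyck_meetE x_id // y_id // minnn.
Qed.

Fact rise_pred_up x y : x \in rise_pred -> x <= y -> y \in rise_pred.
Proof.
move=> /rise_predP x_id /dyck_leP le_xy; apply/rise_predP => j le_jk.
by apply/eqP; rewrite eqn_leq dyck_bound -{1}(x_id j le_jk) le_xy.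
Qed.

Definition rise_filter : filter dyck := Filter rise_predI rise_pred_up.

End RiseFilter.

Fact rise_filter_decr k : {subset rise_filter k.+1 <= rise_filter k}.
Proof.
move=> x /rise_predP x_id; apply/rise_predP => j le_jk.
exact/x_id/leqW.
Qed.

Fact rise_filter0 x : x \in rise_filter 0.
Proof. exact/forallP. Qed.

Fact rise_filter1 x : x \in rise_filter 1.
Proof.
apply/forallP => i; apply/implyP; rewrite ltnS leqn0 => /eqP i0.
have := dyck_step x i.
rewrite /fall_step (_ : widen_ord _ _ = ord0) ?dyck_start ?orbF //.
exact: val_inj.
Qed.

(* The recursion starts from beta_0 = D_m.  As rise_filter 0 and rise_filter 1
   are both all of D_m, this gives beta_1 = D_m x 2. *)
Definition beta k : finLatticeType dyck_display :=
  iter_fdouble rise_filter_decr rise_filter0 k.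

End Dyck.

(* Main.v *)
Require Import Defs.
From mathcomp Require Import all_boot all_order.
From mathcomp Require Import zify.

(** Deleting the first peak of a path [y] of [D_(m+1)], reached after [t + 1]
    rise steps, leaves a path [x] of [D_m] starting with at least [t] rise
    steps; conversely, a peak may be inserted in [x] after any [t] of its
    initial rise steps.  This identifies [D_(m+1)] with the pairs [(x, t)] such
    that [t <= m] and [x] is in the filter [F_t], ordered coordinatewise.
    On the other side, the marks [e_1, ..., e_k] of an element
    [(x, e_1, ..., e_k)] of [beta_k] form a decreasing sequence, which is
    determined by the number [t] of ones, so that [beta_m] consists of the same
    pairs. *)

Import Order.Theory.

Set Implicit Arguments.
Unset Strict Implicit.
Unset Printing Implicit Defensive.

(** By antisymmetry, a relation that preserves and reflects the order is the graph of an order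
    isomorphism once it is total on both sides. Finiteness of [L1] and [L2] turns the existence
    statements into maps [f] and [g]; being adjoint on both sides, they are mutually inverse. *)
Lemma le_correspondence_lattice_isomorphic d1 d2
    (L1 : finLatticeType d1) (L2 : finLatticeType d2) (R : L1 -> L2 -> Prop) :
  (forall x, exists y, R x y) -> (forall y, exists x, R x y) ->
  (forall x y x' y', R x y -> R x' y' -> (x <= x')%O = (y <= y')%O) ->
  lattice_isomorphic L1 L2.
Proof.
move=> /fin_all_exists[f Rf] /fin_all_exists[g Rg] Rle.
have fg_le x y : (f x <= y)%O = (x <= g y)%O
  by rewrite (Rle _ _ _ _ (Rf x) (Rg y)).
have gf_le x y : (y <= f x)%O = (g y <= x)%O
  by rewrite (Rle _ _ _ _ (Rg y) (Rf x)).
have fK : cancel f g by move=> x; apply: le_anti; rewrite -gf_le -fg_le lexx.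
have gK : cancel g f by move=> y; apply: le_anti; rewrite fg_le gf_le lexx.
exists f; split; first by exists g.
- move=> x y; apply: le_anti.
  by rewrite lexI !fg_le !fK leIl leIr gf_le lexI -!gf_le leIl leIr.
- move=> x y; apply: le_anti.
  by rewrite leUx !gf_le !fK leUl leUr fg_le leUx -!fg_le leUl leUr.
Qed.

Section Coordinates.
Context (d : Order.disp_t) (D : finLatticeType d) (F : nat -> Defs.filter D).
Hypothesis F_decr : forall k, {subset F k.+1 <= F k}.
Hypothesis F0 : forall x, x \in F 0.

(* The pair [p b] consists of the component of [b] in [D] and of the number of
   ones among its marks. *)
Lemma iter_fdouble_coordinates k :
  exists p : iter_fdouble F_decr F0 k -> D * nat,
    [/\ forall b, ((p b).2 <= k) && ((p b).1 \in F (p b).2),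
        forall b c,
          (b <= c)%O = ((p b).1 <= (p c).1)%O && ((p b).2 <= (p c).2),
        forall x t, t <= k -> x \in F t -> exists b, p b = (x, t) &
        forall x, p (bracket (stages F_decr F0 k) x) = (val x, k)].
Proof.
elim: k => [|k [p [p_in p_le p_surj p_bracket]]].
  exists (fun x => (x, 0)); split=> //.
  - by move=> b c; rewrite andbT.
  - by move=> x t; rewrite leqn0 => /eqP-> _; exists x.
pose q (b : fdouble (next_filter F_decr (stages F_decr F0 k))) :=
  if (val b).2 then ((p (val b).1).1, k.+1) else p (val b).1.
(* Only brackets may receive a new mark 1, and all their earlier marks are 1; hence the count [k.+1]
   in [q]. *)
have bracketP b : b \in next_filter F_decr (stages F_decr F0 k) ->
    ((p b).2 = k) /\ ((p b).1 \in F k.+1).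
  by case/existsP => x /eqP->; rewrite p_bracket; split=> //; exact: (valP x).
exists q; split.
- case=> -[b []] /= Fb; rewrite /q /=; last first.
    by case/andP: (p_in b) => le_k ->; rewrite andbT leqW.
  by rewrite leqnn; case: (bracketP b Fb).
- move=> b c; rewrite fdouble_leE p_le /q.
  case: b c => -[b eb] Fb [[c ec] Fc] /=.
  case: eb Fb => Fb; case: ec Fc => Fc /=; rewrite ?andbT ?leqnn ?andbT.
  + by rewrite (bracketP b Fb).1 (bracketP c Fc).1 leqnn andbT.
  + by case/andP: (p_in c) => le_k _; rewrite andbF ltnNge le_k andbF.
  + by rewrite (bracketP c Fc).1; case/andP: (p_in b) => le_k _; rewrite le_k leqW.
  + by [].
- move=> x t; rewrite leq_eqVlt => /orP[/eqP-> Fx|lt_tk Fx].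
    exists (next_bracket F_decr (stages F_decr F0 k) (exist _ x Fx)).
    by rewrite /q /= p_bracket.
  have [b pb] := p_surj x t lt_tk Fx.
  have Fb : fdouble_pred (next_filter F_decr (stages F_decr F0 k)) (b, false).
    by [].
  by exists (FDouble Fb).
- by move=> x; rewrite /q /= p_bracket.
Qed.

End Coordinates.

Section Height.
Context (m : nat).
Implicit Types (x y : dyck m).

(* Junk value: [height x i] is [x 0 = 0] when [i > 2m]. *)
Definition height x i := x (inord i).

Lemma height_ord x (j : 'I_m.*2.+1) : x j = height x j.
Proof. by rewrite /height inord_val. Qed.

Lemma height0 x : height x 0 = 0.
Proof. by rewrite -(height_ord x ord0) dyck_start. Qed.

Lemma height_end x : height x m.*2 = 0.
Proof. by rewrite -(height_ord x ord_max) dyck_end. Qed.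

Lemma height_step x i : i < m.*2 ->
  (height x i.+1 == (height x i).+1) || (height x i == (height x i.+1).+1).
Proof.
move=> lt_i; have := dyck_step x (Ordinal lt_i).
by rewrite /rise_step /fall_step !height_ord lift0.
Qed.

(** Each remaining step lowers the path by at most 1, and it must end at 0. The induction runs
    backwards from the end. *)
Lemma height_le_rest x i : i <= m.*2 -> height x i <= m.*2 - i.
Proof.
move=> le_i; rewrite -{1}(subKn le_i); have := leq_subr i m.*2.
elim: (m.*2 - i) => [|j IHj] lt_j; first by rewrite subn0 height_end.
have := IHj (ltnW lt_j); have lt_i : m.*2 - j.+1 < m.*2 by lia.
have := height_step x lt_i; rewrite subnSK //; lia.
Qed.

Lemma leEheight x y :
  reflect (forall i, i <= m.*2 -> height x i <= height y i) (x <= y)%O.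
Proof.
apply: (iffP (dyck_leP x y)) => [le_xy i _ | le_xy j]; first exact: le_xy.
by rewrite !height_ord le_xy // -ltnS.
Qed.

Lemma rise_filter_height k x : k <= m.*2 ->
  reflect (forall i, i <= k -> height x i = i) (x \in rise_filter m k).
Proof.
move=> le_k; apply: (iffP (rise_predP k x)) => [x_id i le_i | x_id j le_j].
  by rewrite /height x_id inordK //; lia.
by rewrite height_ord x_id.
Qed.

Lemma exists_dyck (h : nat -> nat) : h 0 = 0 -> h m.*2 = 0 ->
  (forall i, i < m.*2 -> (h i.+1 == (h i).+1) || (h i == (h i.+1).+1)) ->
  exists x : dyck m, forall i, i <= m.*2 -> height x i = h i.
Proof.
move=> h0 h_end h_step.
have dyck_h : is_dyck [ffun j : 'I_m.*2.+1 => h j].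
  rewrite /is_dyck !ffunE /= h0 h_end /=; apply/forallP => i.
  by rewrite /rise_step /fall_step !ffunE lift0 h_step.
by exists (Dyck dyck_h) => i le_i; rewrite /height /= ffunE inordK.
Qed.

End Height.

Section FirstPeak.
Context (m : nat).
Implicit Types (y : dyck m.+1) (x : dyck m).

(** Index [t.+1] is the tip of the new peak; from [t.+2] on, [y] is [x] delayed by two steps. *)
Definition peak_insertion x t y := forall i, i <= m.*2.+2 ->
  height y i = if i <= t.+1 then i else height x (i - 2).

Lemma exists_peak_insertion x t : t <= m -> x \in rise_filter m t ->
  exists y, peak_insertion x t y.
Proof.
move=> le_tm /rise_filter_height x_id.
have {}x_id i : i <= t -> height x i = i by apply: x_id; lia.
apply: (@exists_dyck m.+1 (fun i => if i <= t.+1 then i else height x (i - 2))).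
- by [].
- rewrite ifF; last by lia.
  by rewrite doubleS subn2 height_end.
- move=> i; rewrite doubleS => lt_i.
  case: (ltngtP i t.+1) => [lt_it|gt_it|->]; first by rewrite eqxx.
  + have -> : i.+1 - 2 = (i - 2).+1 by lia.
    by apply: height_step; lia.
  (* This is the fall of the new peak, from [t.+1] to [height x t], which is [t]. *)
  + by rewrite !subSS subn0 x_id // eqxx orbT.
Qed.

Lemma exists_first_peak y : exists x t,
  [/\ t <= m, x \in rise_filter m t & peak_insertion x t y].
Proof.
have y_end := height_end y.
have ex_fall : exists i, height y i.+1 != i.+1.
  by exists m.*2.+1; rewrite -doubleS y_end.
(* The least such index is that of the first fall step; it is not 0, as every path starts with a
   rise. *)
case: (ex_minnP ex_fall) => -[|t] fall_t min_t.
  case/negP: fall_t.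
  by have /rise_filter_height-> := rise_filter1 y.
have y_id i : i <= t.+1 -> height y i = i.
  case: i => [|i le_it]; first by rewrite height0.
  by apply/eqP; apply: contraTT le_it => /min_t; rewrite -ltnNge.
have lt_t : t.+1 < m.*2.+2.
  rewrite ltnNge; apply/negP => /y_id; rewrite -doubleS y_end; lia.
(* Height [t.+1] must be descended in the [m.*2.+2 - t.+1] steps left. *)
have le_tm : t <= m.
  have := @height_le_rest _ y t.+1 (ltnW lt_t); rewrite y_id // doubleS; lia.
have y_t : height y t.+2 = t.
  have := @height_step _ y t.+1 lt_t.
  by rewrite (y_id t.+1) // (negbTE fall_t) => /eqP[].
case: (@exists_dyck m (fun i => if i <= t then i else height y i.+2)).
- by [].
- case: ifP => [|_]; first by lia.
  by rewrite -doubleS.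
- move=> i lt_i; case: (ltngtP i t) => [lt_it|gt_it|->]; first by rewrite eqxx.
  + by apply: height_step; rewrite doubleS; lia.
  (* The two ends of the deleted peak have the same height [t], so step [t] of [x] is step [t.+2] of
     [y]. *)
  + rewrite -{2 3}y_t; apply: height_step; rewrite doubleS; lia.
- move=> x xE; exists x, t; split=> //.
    apply/rise_filter_height => [|i le_it]; first by lia.
    by rewrite xE ?le_it //; lia.
  move=> i le_i; case: ifP => [/y_id //|lt_ti].
  rewrite xE; last by lia.
  case: ifP => [le_it|_]; last by congr height; lia.
  have -> : i = t.+2 by lia.
  by rewrite y_t; lia.
Qed.

Lemma peak_insertion_le x t y x' t' y' :
  t <= m -> x \in rise_filter m t -> t' <= m -> x' \in rise_filter m t' ->
  peak_insertion x t y -> peak_insertion x' t' y' ->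
  (y <= y')%O = (x <= x')%O && (t <= t').
Proof.
move=> le_tm /rise_filter_height x_id le_tm' /rise_filter_height x'_id yE y'E.
have {}x_id i : i <= t -> height x i = i by apply: x_id; lia.
have {}x'_id i : i <= t' -> height x' i = i by apply: x'_id; lia.
apply/leEheight/andP => [le_y | [/leEheight le_x le_t] i]; last first.
  rewrite doubleS => le_i; rewrite yE // y'E //.
  case: (leqP i t.+1) => [le_it|lt_ti]; first by rewrite ifT //; lia.
  (* Up to [t'.+1], [y'] is still on its initial rise, where its height [i] is the largest
     possible. *)
  case: (leqP i t'.+1) => [_|_]; last by apply: le_x; lia.
  by rewrite (leq_trans (dyck_bound _ _)) // inordK; lia.
have le_t : t <= t'.
  rewrite leqNgt; apply/negP => lt_t.
  (* If [t' < t], then at index [t'.+2] the path [y] is still rising, while [y'] has already fallen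
     back to [t']. *)
  have le_t' : t'.+2 <= m.*2.+2 by lia.
  have := le_y t'.+2 le_t'; rewrite yE // y'E // ifT; last by lia.
  by rewrite ltnn subn2 x'_id //=; lia.
split=> //; apply/leEheight => i le_i; case: (leqP i t') => [le_it|lt_ti].
  by rewrite x'_id // (leq_trans (dyck_bound _ _)) // inordK; lia.
have := le_y i.+2; rewrite doubleS !ltnS => /(_ le_i).
rewrite yE // y'E // !subn2 /= !ifF //; lia.
Qed.

End FirstPeak.

Theorem theorem3p2 (n : nat) (hn : 2 <= n) :
  lattice_isomorphic (dyck n) (beta n.-1 n.-1).
Proof.
case: n hn => // m _.
have [p [p_in p_le p_surj _]] :=
  iter_fdouble_coordinates (@rise_filter_decr m) (@rise_filter0 m) m.
apply: (@le_correspondence_lattice_isomorphic _ _ _ _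
  (fun y b => peak_insertion (p b).1 (p b).2 y)).
- move=> y; have [x [t [le_tm Fx yE]]] := exists_first_peak y.
  by have [b pb] := p_surj x t le_tm Fx; exists b; rewrite pb.
- by move=> b; case/andP: (p_in b); exact: exists_peak_insertion.
- move=> y b y' b' yE yE'.
  case/andP: (p_in b) => le_b Fb; case/andP: (p_in b') => le_b' Fb'.
  by rewrite p_le (peak_insertion_le le_b Fb le_b' Fb' yE yE').
Qed.
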